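(* Let $(E,\mathcal E,\mu)$ be a measure space and let $\mathcal E'\subseteq\mathcal E$ be arbitrary. Then $\widetilde{\mathcal E'}$ is totally bounded in $(\widetilde{\mathcal E},d_\mu)$ if and only if there exists a filtration $\mathcal F=(\mathcal F_n)_{n\in\mathbb N}$ such that $\mu$ is uniformly approximable on $\mathcal E'$ with respect to $\mathcal F$ and $|\mathcal F_n|$ is finite for each $n\in\mathbb N$.
   Context: The measure $\mu$ is arbitrary (possibly infinite). For $A\in\mathcal E$ let $[A]=\{B\in\mathcal E:\mu(A\Delta B)=0\}$, where $\Delta$ is symmetric difference, and $\widetilde{\mathcal E}=\{[A]:A\in\mathcal E\}$. For $\mathcal E'\subseteq\mathcal E$ put $\widetilde{\mathcal E'}=\{[A]:A\in\mathcal E'\}$. The metric, possibly taking the value $\infty$, is $d_\mu([A],[B])=\mu(A\Delta B)^{1/2}$ on $\widetilde{\mathcal E}$. A subset $S$ of a metric space $X$ is totally bounded if for each real $r>0$ there is a finite collection of balls of $X$ of radius $r$ that covers $S$. A filtration is a sequence $\mathcal F=(\mathcal F_n)_{n\in\mathbb N}$ of $\sigma$-algebras on $E$ with $\mathcal F_n\subseteq\mathcal E$ and $\mathcal F_n\subseteq\mathcal F_{n+1}$ for all $n$. The measure $\mu$ is uniformly approximable on $\mathcal E'$ with respect to $\mathcal F$ if for each $\epsilon>0$ there exists $n_\epsilon\in\mathbb N$ such that for every $A\in\mathcal E'$ there exists $A'\in\mathcal F_{n_\epsilon}$ with $\mu(A\Delta A')<\epsilon$. *)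

(* Defs.v *)
From HB Require Import structures.
From mathcomp Require Import all_boot all_order all_algebra.
From mathcomp Require Import all_classical all_reals all_analysis.

Set Implicit Arguments.
Unset Strict Implicit.
Unset Printing Implicit Defensive.

Import Order.TTheory GRing.Theory Num.Theory.

Local Open Scope classical_set_scope.
Local Open Scope ring_scope.
Local Open Scope ereal_scope.

Definition ae_class (d : measure_display) (T : measurableType d) (R : realType)
    (mu : {measure set T -> \bar R}) (A : set T) : set (set T) :=
  [set B | measurable B /\ mu (A `+` B) = 0].

Definition ae_classes (d : measure_display) (T : measurableType d)
    (R : realType) (mu : {measure set T -> \bar R}) (G : set (set T)) :
    set (set (set T)) :=
  [set ae_class mu A | A in G].

(* [get] picks a representative of a class; by [dmuE] below the value does not
   depend on the choice when the arguments are classes of measurable sets. *)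
Definition dmu (d : measure_display) (T : measurableType d) (R : realType)
    (mu : {measure set T -> \bar R}) (C D : set (set T)) : \bar R :=
  mu (get C `+` get D) `^ 2^-1.

Definition ext_ball (R : realType) (U : Type) (X : set U)
    (dist : U -> U -> \bar R) (x : U) (r : R) : set U :=
  [set y | X y /\ dist x y < r%:E].

(* The metric space is the set [X], with a possibly infinite distance; the
   centers of the balls are points of [X], not necessarily of [S]. *)
Definition totally_bounded (R : realType) (U : Type) (X : set U)
    (dist : U -> U -> \bar R) (S : set U) : Prop :=
  forall r : R, (0 < r)%R ->
    exists F : set U, [/\ finite_set F, F `<=` X
      & S `<=` \bigcup_(x in F) ext_ball X dist x r].

Definition filtration (d : measure_display) (T : measurableType d)
    (F : nat -> set (set T)) : Prop :=
  [/\ forall n, sigma_algebra [set: T] (F n),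
      forall n, F n `<=` measurable
    & forall n, F n `<=` F n.+1].

Definition uniformly_approximable (d : measure_display) (T : measurableType d)
    (R : realType) (mu : {measure set T -> \bar R}) (G : set (set T))
    (F : nat -> set (set T)) : Prop :=
  forall eps : R, (0 < eps)%R ->
    exists n : nat, forall A, G A ->
      exists2 A', F n A' & mu (A `+` A') < eps%:E.

Lemma measurableY (d : measure_display) (T : measurableType d) (A B : set T) :
  measurable A -> measurable B -> measurable (A `+` B).
Proof. by move=> mA mB; apply: measurableU; apply: measurableD. Qed.

Lemma le_measureY (d : measure_display) (T : measurableType d) (R : realType)
    (mu : {measure set T -> \bar R}) (A B C : set T) :
  measurable A -> measurable B -> measurable C ->
  mu (A `+` C) <= mu (A `+` B) + mu (B `+` C).
Proof.
move=> mA mB mC.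
have mAB := measurableY mA mB; have mBC := measurableY mB mC.
apply: (@le_trans _ _ (mu ((A `+` B) `|` (B `+` C)))).
  apply: le_measure; rewrite ?inE; [exact: measurableY|exact: measurableU|].
  move=> x [[Ax nCx]|[Cx nAx]]; have [Bx|nBx] := pselect (B x).
  - by right; left.
  - by left; left.
  - by left; right.
  - by right; right.
exact: measureU2.
Qed.

Lemma dmuE (d : measure_display) (T : measurableType d) (R : realType)
    (mu : {measure set T -> \bar R}) (A B : set T) :
  measurable A -> measurable B ->
  dmu mu (ae_class mu A) (ae_class mu B) = mu (A `+` B) `^ 2^-1.
Proof.
have getP C : measurable C ->
    measurable (get (ae_class mu C)) /\ mu (C `+` get (ae_class mu C)) = 0.
  move=> mC; apply: (getPex (P := ae_class mu C)); exists C.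
  by split=> //; rewrite setYK measure0.
move=> mA mB; rewrite /dmu.
have [] := getP _ mA; set A' := get (ae_class mu A) => mA' A'0.
have [] := getP _ mB; set B' := get (ae_class mu B) => mB' B'0.
congr (_ `^ _); apply/eqP; rewrite eq_le; apply/andP; split.
  apply: (le_trans (le_measureY mu mA' mA mB')); rewrite setYC A'0 add0e.
  by apply: (le_trans (le_measureY mu mA mB mB')); rewrite B'0 adde0.
apply: (le_trans (le_measureY mu mA mA' mB)); rewrite A'0 add0e.
apply: (le_trans (le_measureY mu mA' mB' mB)).
by rewrite (setYC B') B'0 adde0.
Qed.

(* Main.v *)
Require Import Defs.
From HB Require Import structures.
From mathcomp Require Import all_boot all_order all_algebra.
From mathcomp Require Import all_classical all_reals all_analysis.

Import Order.TTheory GRing.Theory Num.Theory.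

Local Open Scope classical_set_scope.
Local Open Scope ring_scope.

(** By [dmuE] and [lt_poweR2V], a ball of radius r around the class of B consists of the classes of
    the measurable A with mu (A [+] B) < r ^+ 2, so a finite net is just a finite family of
    measurable sets approximating all of [E']. Nets for finer and finer radii, accumulated and
    closed into sigma-algebras, form the filtration; these stay finite by [finite_g_sigma_algebra].
    Conversely, the members of one finite [F n] already serve as the centers of a net. *)

Lemma finite_setT_set (X : finType) : finite_set [set: set X].
Proof.
suff -> : [set: set X] = (fun U : {set X} => [set` U]) @` setT.
  exact/finite_image/finite_finset.
apply/esym/seteqP; split=> // U _; exists [set x | `[< U x >]]%SET => //.
by apply/seteqP; split=> x /=; rewrite inE => /asboolP.
Qed.

(* The atoms are indexed by the sets of generators containing a given point, so
   every member is the preimage of a set of such codes. *)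
Lemma finite_g_sigma_algebra (T : Type) (G : set (set T)) :
  finite_set G -> finite_set <<s G >>.
Proof.
move=> /finite_seqP[s ->].
pose code (x : T) : {ffun 'I_(size s) -> bool} := [ffun i : 'I__ => `[< nth set0 s i x >]].
pose P := preimage_set_system setT code setT.
have sP : sigma_algebra setT P by apply: sigma_algebra_preimage.
(* There are finitely many sets of codes, hence finitely many preimages in [P]; by minimality it
   remains to see that each generator lies in [P]. *)
apply: (@sub_finite_set _ _ P); last exact/finite_image/finite_setT_set.
apply: smallest_sub => // A /= As.
have iA : (index A s < size s)%N by rewrite index_mem.
exists [set v : {ffun _ -> bool} | v (Ordinal iA)] => //; rewrite setTI.
apply/seteqP; split=> x /=; rewrite ffunE nth_index //.
  by move/asboolP.
by move=> Ax; apply/asboolP.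
Qed.

(** Turns a radius for [dmu] into a bound on the measure; at [+oo] both sides are false. *)
Lemma lt_poweR2V (R : realType) (x : \bar R) (r : R) : (0 <= x)%E -> 0 < r ->
  (x `^ 2^-1 < r%:E)%E = (x < (r ^+ 2)%:E)%E.
Proof.
move=> x0 r0.
case: x x0 => [x| |]//; last by move=> _; rewrite poweRyr //.
rewrite lee_fin => x0; rewrite poweR_EFin !lte_fin powR12_sqrt//.
by rewrite -[in LHS](@gtr0_norm _ r)// -sqrtr_sqr ltr_sqrt// exprn_gt0.
Qed.

Theorem theorem3p2 (d : measure_display) (T : measurableType d) (R : realType)
    (mu : {measure set T -> \bar R}) (E' : set (set T))
    (hE' : E' `<=` measurable) :
  totally_bounded (ae_classes mu measurable) (dmu mu) (ae_classes mu E') <->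
  exists F : nat -> set (set T),
    [/\ filtration F, uniformly_approximable mu E' F
      & forall n, finite_set (F n)].
Proof.
split=> [tb|[F [[_ mF _] ua finF]] r r0].
- have net n : exists H : set (set T), [/\ finite_set H, H `<=` measurable &
      forall A, E' A -> exists2 B, H B & (mu (A `+` B) < n.+1%:R^-1%:E)%E].
    (* This radius squares to the wanted bound 1/(n+1). *)
    have rn0 : 0 < Num.sqrt (n.+1%:R^-1 : R) by rewrite sqrtr_gt0 invr_gt0.
    have [C [finC Cm coverC]] := tb _ rn0.
    have rep c : exists B, C c -> measurable B /\ c = ae_class mu B.
      have [/Cm[B mB <-]|nCc] := pselect (C c); last by exists set0.
      by exists B.
    have [g gP] := choice rep.
    exists (g @` C); split; first exact: finite_image.
      by move=> _ [c Cc <-]; have [] := gP _ Cc.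
    move=> A EA; have [|c Cc [_]] := coverC (ae_class mu A).
      by exists A.
    have [mB eB] := gP _ Cc; rewrite {1}eB dmuE//; last exact: hE'.
    rewrite lt_poweR2V// sqr_sqrtr ?invr_ge0// setYC => AB.
    by exists (g c) => //; exists c.
  have [H HP] := choice net.
  (* The nets need not be nested; collecting all those of index at most n makes the generated
     sigma-algebras increase. *)
  pose G n := \bigcup_(k in `I_n.+1) H k.
  exists (fun n => <<s G n >>); split.
  + split=> [n|n|n]; first exact: smallest_sigma_algebra.
      apply: smallest_sub; first exact: sigma_algebra_measurable.
      by move=> B [k _ HB]; have [_ + _] := HP k; apply.
    apply: sub_sigma_algebra2 => B [k kn HB]; exists k => //=.
    exact: ltnW.
  + move=> e e0; have [n _ ne] := near_infty_natSinv_lt (PosNum e0).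
    exists n => A EA; have [_ _ /(_ A EA)[B HB AB]] := HP n.
    exists B; first by apply: sub_sigma_algebra; exists n => /=.
    by apply: lt_trans AB _; rewrite lte_fin; apply: ne => /=.
  + move=> n; apply: finite_g_sigma_algebra; apply: bigcup_finite => // k _.
    by have [] := HP k.
(* Approximation within r ^+ 2 in measure is distance less than r. *)
- have [n approx] := ua _ (exprn_gt0 2 r0).
  exists (ae_class mu @` F n); split; first exact: finite_image.
    by move=> _ [B FB <-]; exists B => //; apply: mF FB.
  move=> _ [A EA <-]; have [B FB AB] := approx A EA.
  have mA := hE' _ EA; have mB := mF _ _ FB.
  exists (ae_class mu B); first by exists B.
  split; first by exists A.
  by rewrite dmuE// lt_poweR2V// setYC.
Qed.
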